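(* Let $f:\mathbb{N}\to\mathbb{R}$ be a superpolynomial function with $f(r)\ge 3r+1$ for every $r\in\mathbb{N}$. Then the class of graphs with growth at most $f$ has unbounded asymptotic dimension, i.e.\ for no integer $n$ does it have asymptotic dimension at most $n$.
   Context: A function $f$ is superpolynomial if it can be written as $f(r)=r^{g(r)}$ with $g(r)\to\infty$ as $r\to\infty$. A graph has growth at most $f$ if for every integer $r$ and every vertex $v$, at most $f(r)$ vertices are at shortest-path distance at most $r$ from $v$. Graphs are metric spaces with the shortest-path distance. For a metric space $(X,d)$, a family $\mathcal U$ of subsets is $D$-bounded if every member has diameter at most $D$, and $r$-disjoint if points in different members are at distance $>r$. A function $D:\mathbb{R}^+\to\mathbb{R}^+$ is an $n$-dimensional control function for $X$ if for every $r>0$ there is a cover $\mathcal U=\mathcal U_1\cup\dots\cup\mathcal U_{n+1}$ of $X$ with each $\mathcal U_i$ $r$-disjoint and each member $D(r)$-bounded; a class has asymptotic dimension at most $n$ if one such function works for all its members. *)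

(* Defs.v *)
From Stdlib Require Import Reals Lra List.
Open Scope R_scope.

Definition simple_graph {V : Type} (adj : V -> V -> Prop) : Prop :=
  (forall u v, adj u v -> adj v u) /\ (forall v, ~ adj v v).

Fixpoint reach {V : Type} (adj : V -> V -> Prop) (n : nat) (u v : V) : Prop :=
  match n with
  | O => u = v
  | S m => u = v \/ exists w, adj u w /\ reach adj m w v
  end.

Definition dist_le {V : Type} (adj : V -> V -> Prop) (u v : V) (r : R) : Prop :=
  exists n : nat, INR n <= r /\ reach adj n u v.

Definition has_growth_at_most {V : Type} (adj : V -> V -> Prop) (f : nat -> R) : Prop :=
  forall (r : nat) (v : V), exists l : list V,
    NoDup l /\ (forall u, In u l <-> dist_le adj u v (INR r)) /\ INR (length l) <= f r.

Definition superpolynomial (f : nat -> R) : Prop :=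
  exists g : nat -> R,
    (exists N : nat, forall r : nat, (N <= r)%nat -> f r = Rpower (INR r) (g r)) /\
    (forall M : R, exists N : nat, forall r : nat, (N <= r)%nat -> M <= g r).

Definition r_disjoint {V : Type} (adj : V -> V -> Prop)
    (U : (V -> Prop) -> Prop) (r : R) : Prop :=
  forall A B x y, U A -> U B -> A x -> B y ->
    ~ (forall z, A z <-> B z) -> ~ dist_le adj x y r.

Definition D_bounded {V : Type} (adj : V -> V -> Prop)
    (U : (V -> Prop) -> Prop) (D : R) : Prop :=
  forall A x y, U A -> A x -> A y -> dist_le adj x y D.

Definition control_function {V : Type} (adj : V -> V -> Prop) (n : nat) (D : R -> R) : Prop :=
  forall r : R, 0 < r ->
    exists U : nat -> ((V -> Prop) -> Prop),
      (forall x : V, exists i A, (i <= n)%nat /\ U i A /\ A x) /\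
      (forall i, (i <= n)%nat -> r_disjoint adj (U i) r /\ D_bounded adj (U i) (D r)).

Definition graph_class := forall V : Type, (V -> V -> Prop) -> Prop.

Definition class_asdim_le (C : graph_class) (n : nat) : Prop :=
  exists D : R -> R, (forall r, 0 < r -> 0 < D r) /\
    forall (V : Type) (adj : V -> V -> Prop), C V adj -> control_function adj n D.

Definition growth_class (f : nat -> R) : graph_class :=
  fun V adj => simple_graph adj /\ has_growth_at_most adj f.

(* Main.v *)
(** For [d = n + 1], take a cubic graph quasi-isometric to the grid [nat^d] and subdivide
    its edges so finely that a ball of radius [r] below the subdivision scale is contained
    in a tripod, hence has at most [3 r + 1] vertices. Larger balls have size at most a fixed
    power of [r], which is below [f r] as [f] is superpolynomial. A single such graph has no
    [n]-dimensional control function: given [n + 1] colour families of [D]-bounded,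
    [r]-disjoint sets, label a grid point by the highest face [x_j = 0] met by its set
    (or [0]). This is a Sperner labelling of a cube of side larger than [D], so some small
    simplex carries all [d + 1 = n + 2] labels. Its vertices then lie in [n + 2] different
    sets that are [r]-close to each other, hence of different colours: a contradiction.

    Sperner's lemma is proved by Stokes' formula for mod 2 cochains on the product
    triangulation of the cube, where full labellings are an iterated coboundary. *)

Require Import Defs.
From Stdlib Require Import Reals Lra Lia List Arith Bool Classical ClassicalEpsilon
  IndefiniteDescription.
Import ListNotations.
Open Scope nat_scope.

(** * Sperner's lemma on the grid *)

(** The mod 2 simplicial coboundary: [phi] is summed over all lists obtained from [l] by deleting
    one entry. *)
Fixpoint cobd {T : Type} (l : list T) (phi : list T -> bool) : bool :=
  match l with
  | [] => false
  | v :: l' => xorb (phi l') (cobd l' (fun m => phi (v :: m)))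
  end.

Lemma cobd_ext {T : Type} (l : list T) phi psi :
  (forall m, incl m l -> phi m = psi m) -> cobd l phi = cobd l psi.
Proof.
  revert phi psi; induction l as [|v l IH]; intros phi psi H; simpl; auto.
  f_equal.
  - apply H, incl_tl, incl_refl.
  - apply IH; intros m Hm; apply H.
    intros x [<-|Hx]; [left | right]; auto.
Qed.

Lemma cobd_xorb {T : Type} (l : list T) phi psi :
  cobd l (fun m => xorb (phi m) (psi m)) = xorb (cobd l phi) (cobd l psi).
Proof.
  revert phi psi; induction l as [|v l IH]; intros phi psi; simpl; auto.
  rewrite IH.
  destruct (phi l), (psi l), (cobd l _), (cobd l _); reflexivity.
Qed.

Lemma cobd_true {T : Type} (l : list T) phi :
  cobd l phi = true -> exists m, incl m l /\ phi m = true.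
Proof.
  revert phi; induction l as [|v l IH]; intros phi; simpl; [discriminate|].
  destruct (phi l) eqn:E.
  - intros _; exists l; split; auto. apply incl_tl, incl_refl.
  - rewrite xorb_false_l; intros H; apply IH in H as [m [Hm Hp]].
    exists (v :: m); split; auto.
    intros x [<-|Hx]; [left | right]; auto.
Qed.

Lemma cobd_cobd {T : Type} (l : list T) phi :
  cobd l (fun m => cobd m phi) = false.
Proof.
  revert phi; induction l as [|v l IH]; intros phi; simpl; auto.
  rewrite cobd_xorb, IH, xorb_false_r. apply xorb_nilpotent.
Qed.

Lemma cobd_map {S T : Type} (h : S -> T) (l : list S) phi :
  cobd (map h l) phi = cobd l (fun m => phi (map h m)).
Proof.
  revert phi; induction l as [|v l IH]; intros phi; simpl; auto.
  now rewrite IH.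
Qed.

(* Lists of length [k] with labels [0, ..., k-1] in some order; the recursion is chosen so
   that [rainbow k] is the coboundary of [rainbow (k-1)] on labels below [k]. *)
Fixpoint rainbow (k : nat) (s : list nat) : bool :=
  match k with
  | 0 => match s with [] => true | _ => false end
  | S k' => forallb (fun a => a <? k) s && cobd s (rainbow k')
  end.

Lemma rainbow_lt k s a : rainbow k s = true -> In a s -> a < k.
Proof.
  destruct k; simpl.
  - destruct s; [contradiction | discriminate].
  - intros H Ha; apply andb_prop in H as [H _].
    rewrite forallb_forall in H. apply Nat.ltb_lt; auto.
Qed.

Lemma rainbow_succ k s :
  (forall a, In a s -> a < S k) -> rainbow (S k) s = cobd s (rainbow k).
Proof.
  intros H; cbn [rainbow].
  replace (forallb _ s) with true; auto.
  symmetry; apply forallb_forall; intros a Ha; apply Nat.ltb_lt; auto.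
Qed.

(** On labels below [k], [rainbow k] is itself the coboundary of [rainbow (k-1)], and a double
    coboundary vanishes. *)
Lemma cobd_rainbow_low k s :
  (forall a, In a s -> a < k) -> cobd s (rainbow k) = false.
Proof.
  destruct k as [|k]; intros H.
  - destruct s as [|a s]; auto. specialize (H a (or_introl eq_refl)); lia.
  - rewrite <- (cobd_cobd s (rainbow k)). apply cobd_ext.
    intros m Hm; apply rainbow_succ; intros a Ha; auto.
Qed.

Lemma rainbow_In k s j : rainbow k s = true -> j < k -> In j s.
Proof.
  revert s j; induction k as [|k IH]; intros s j H Hj; [lia|].
  pose proof (fun a => rainbow_lt (S k) s a H) as Hlt.
  rewrite rainbow_succ in H by auto.
  destruct (Nat.eq_dec j k) as [->|Hne].
  - destruct (in_dec Nat.eq_dec k s) as [|Hn]; auto.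
    rewrite cobd_rainbow_low in H; [discriminate|].
    intros a Ha. assert (a <> k) by (intros ->; auto). specialize (Hlt a Ha); lia.
  - apply cobd_true in H as [m [Hm Hr]]. apply Hm, (IH m); auto; lia.
Qed.

(* Dual of the prism decomposition of [l * [t, t+1]]. *)
Fixpoint prism (t : nat) (l : list (list nat)) (phi : list (list nat) -> bool) : bool :=
  match l with
  | [] => false
  | v :: l' => xorb (phi ((t :: v) :: (S t :: v) :: map (cons (S t)) l'))
                    (prism t l' (fun m => phi ((t :: v) :: m)))
  end.

Lemma prism_ext t l phi psi :
  (forall m, phi m = psi m) -> prism t l phi = prism t l psi.
Proof.
  revert phi psi; induction l as [|v l IH]; intros phi psi H; simpl; auto.
  rewrite H. f_equal. apply IH; auto.
Qed.

Lemma prism_xorb t l phi psi :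
  prism t l (fun m => xorb (phi m) (psi m)) = xorb (prism t l phi) (prism t l psi).
Proof.
  revert phi psi; induction l as [|v l IH]; intros phi psi; simpl; auto.
  rewrite IH.
  destruct (phi _), (psi _), (prism t l _), (prism t l _); reflexivity.
Qed.

Lemma prism_true t l phi :
  prism t l phi = true ->
  exists m, phi m = true /\
    forall u, In u m -> exists v, In v l /\ (u = t :: v \/ u = S t :: v).
Proof.
  revert phi; induction l as [|v l IH]; intros phi; simpl; [discriminate|].
  destruct (phi _) eqn:E.
  - intros _; eexists; split; [exact E|].
    intros u [<-|[<-|Hu]]; [exists v; auto | exists v; auto |].
    apply in_map_iff in Hu as [w [<- Hw]]. exists w; auto.
  - rewrite xorb_false_l; intros H; apply IH in H as [m [Hp Hm]].
    eexists; split; [exact Hp|].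
    intros u [<-|Hu]; [exists v; auto|].
    destruct (Hm u Hu) as [w [Hw Hor]]. exists w; auto.
Qed.

(** Dual of the boundary formula for a prism: the boundary of [l * [t, t+1]] is the prism over the
    boundary of [l] together with the top and bottom copies of [l]. *)
Lemma prism_cobd t l phi :
  prism t l (fun m => cobd m phi) =
  xorb (cobd l (fun m => prism t m phi))
       (xorb (phi (map (cons (S t)) l)) (phi (map (cons t) l))).
Proof.
  revert phi; induction l as [|v l IH]; intros phi; simpl.
  - now rewrite xorb_nilpotent.
  - rewrite cobd_xorb, prism_xorb, IH, cobd_map.
    destruct (phi _), (phi _), (phi _), (cobd l _), (cobd l _), (prism t l _);
      reflexivity.
Qed.

Fixpoint xsum (n : nat) (F : nat -> bool) : bool :=
  match n with
  | 0 => false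
  | S n' => xorb (F n') (xsum n' F)
  end.

Lemma xsum_ext n F G : (forall t, F t = G t) -> xsum n F = xsum n G.
Proof. intros H; induction n as [|n IH]; simpl; congruence. Qed.

Lemma xsum_xorb n F G :
  xsum n (fun t => xorb (F t) (G t)) = xorb (xsum n F) (xsum n G).
Proof.
  induction n as [|n IH]; simpl; auto. rewrite IH.
  destruct (F n), (G n), (xsum n F), (xsum n G); reflexivity.
Qed.

Lemma xsum_true n F : xsum n F = true -> exists t, F t = true.
Proof.
  induction n as [|n IH]; simpl; [discriminate|].
  destruct (F n) eqn:E; eauto.
Qed.

Lemma xsum_telescope n F :
  xsum n (fun t => xorb (F (S t)) (F t)) = xorb (F n) (F 0).
Proof.
  induction n as [|n IH]; simpl; [symmetry; apply xorb_nilpotent|].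
  rewrite IH. destruct (F (S n)), (F n), (F 0); reflexivity.
Qed.

(* Pairing of a cochain with the fundamental chain of the triangulated cube [0,N]^d. *)
Fixpoint integral (N d : nat) (phi : list (list nat) -> bool) : bool :=
  match d with
  | 0 => phi [[]]
  | S d' => xsum N (fun t => integral N d' (fun l => prism t l phi))
  end.

Definition near : list nat -> list nat -> Prop :=
  Forall2 (fun a b => a <= S b /\ b <= S a).

Lemma integral_true N d phi :
  integral N d phi = true ->
  exists l, phi l = true /\ (forall x, In x l -> length x = d) /\
    (forall x y, In x l -> In y l -> near x y).
Proof.
  revert phi; induction d as [|d IH]; intros phi; simpl; intros H.
  - exists [[]]; repeat split; auto.
    + intros x [<-|[]]; auto.
    + intros x y [<-|[]] [<-|[]]; constructor.
  - apply xsum_true in H as [t H]. apply IH in H as (l & H & Hl & Hn).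
    apply prism_true in H as (m & H & Hm).
    exists m; repeat split; auto.
    + intros x Hx. destruct (Hm x Hx) as (v & Hv & [->| ->]); simpl; auto.
    + intros x y Hx Hy.
      destruct (Hm x Hx) as (v & Hv & [->| ->]), (Hm y Hy) as (w & Hw & [->| ->]);
        constructor; try lia; apply Hn; auto.
Qed.

Lemma integral_ext N d phi psi :
  (forall l, phi l = psi l) -> integral N d phi = integral N d psi.
Proof.
  revert phi psi; induction d as [|d IH]; intros phi psi H; simpl; auto.
  apply xsum_ext; intros t; apply IH; intros l; apply prism_ext; auto.
Qed.

Lemma integral_xorb N d phi psi :
  integral N d (fun l => xorb (phi l) (psi l)) =
  xorb (integral N d phi) (integral N d psi).
Proof.
  revert phi psi; induction d as [|d IH]; intros phi psi; simpl; auto.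
  rewrite <- xsum_xorb; apply xsum_ext; intros t.
  rewrite <- IH; apply integral_ext; intros l; apply prism_xorb.
Qed.

(** Stokes in the first coordinate: the walls between consecutive slabs cancel in pairs, which
    leaves the faces at [0] and [N] and the lateral boundary. *)
Lemma integral_cobd N d phi :
  integral N (S d) (fun l => cobd l phi) =
  xorb (xsum N (fun t => integral N d (fun l => cobd l (fun m => prism t m phi))))
       (xorb (integral N d (fun l => phi (map (cons N) l)))
             (integral N d (fun l => phi (map (cons 0) l)))).
Proof.
  rewrite <- (xsum_telescope N (fun t => integral N d (fun l => phi (map (cons t) l)))).
  rewrite <- xsum_xorb; simpl; apply xsum_ext; intros t.
  rewrite <- !integral_xorb; apply integral_ext; intros l; apply prism_cobd.
Qed.

Lemma integral_cobd_boundary N d phi :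
  phi [] = false ->
  (forall i c l, i < d -> c = 0 \/ c = N ->
     (forall x, In x l -> nth i x 0 = c) -> phi l = false) ->
  integral N d (fun l => cobd l phi) = false.
Proof.
  revert phi; induction d as [|d IH]; intros phi H0 Hf.
  (* The boundary of a point is the empty simplex. *)
  - simpl. now rewrite H0.
  - assert (Hface : forall c, c = 0 \/ c = N ->
      integral N d (fun l => phi (map (cons c) l)) = false).
    { intros c Hc. apply not_true_is_false; intros H.
      apply integral_true in H as (l & H & _).
      rewrite (Hf 0 c) in H; [discriminate | lia | auto |].
      intros x Hx; apply in_map_iff in Hx as [w [<- _]]; auto. }
    rewrite integral_cobd, !Hface by auto. rewrite xorb_false_r.
    apply not_true_is_false; intros H; apply xsum_true in H as [t H].
    rewrite IH in H; [discriminate | auto |].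
    intros i c l Hi Hc Hl. apply not_true_is_false; intros H1.
    apply prism_true in H1 as (m & H1 & Hm).
    rewrite (Hf (S i) c) in H1; [discriminate | lia | auto |].
    intros x Hx; destruct (Hm x Hx) as (v & Hv & [->| ->]); simpl; auto.
Qed.

(* Coordinate [i] of a point carries the label [d - i]. *)
Lemma integral_rainbow N d (lab : list nat -> nat) :
  (forall x, lab x <= d) ->
  (forall x i, i < d -> nth i x 0 = 0 -> d - i <= lab x) ->
  (forall x i, i < d -> nth i x 0 = N -> lab x <> d - i) ->
  integral N d (fun l => rainbow (S d) (map lab l)) = true.
Proof.
  revert lab; induction d as [|d IH]; intros lab Hle H0 HN.
  - simpl. specialize (Hle []). replace (lab []) with 0 by lia. reflexivity.
  - rewrite (integral_ext N (S d) _
      (fun l => cobd l (fun m => rainbow (S d) (map lab m)))).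
    2:{ intros l. rewrite rainbow_succ, cobd_map; auto.
        intros a Ha; apply in_map_iff in Ha as [x [<- _]].
        specialize (Hle x); lia. }
    rewrite integral_cobd.
    (* Lateral faces contribute nothing: label [0] is missing where coordinate [S i] is [0], and
       label [d - i] where it is [N]. *)
    replace (xsum N _) with false.
    2:{ symmetry; apply not_true_is_false; intros H; apply xsum_true in H as [t H].
        rewrite integral_cobd_boundary in H; [discriminate | auto |].
        intros i c l Hi Hc Hl; apply not_true_is_false; intros H1.
        apply prism_true in H1 as (m & H1 & Hm).
        assert (Hmi : forall x, In x m -> nth (S i) x 0 = c).
        { intros x Hx; destruct (Hm x Hx) as (v & Hv & [->| ->]); simpl; auto. }
        destruct Hc as [->| ->].
        - apply rainbow_In with (j := 0) in H1; [|lia].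
          apply in_map_iff in H1 as (x & Hx & Hxm).
          specialize (H0 x (S i)); rewrite Hx in H0.
          specialize (H0 ltac:(lia) (Hmi x Hxm)); lia.
        - apply rainbow_In with (j := d - i) in H1; [|lia].
          apply in_map_iff in H1 as (x & Hx & Hxm).
          apply (HN x (S i)); auto; lia. }
    (* On the face where the first coordinate is [0] every label is [S d], so label [0] is
       missing. *)
    replace (integral N d (fun l => rainbow (S d) (map lab (map (cons 0) l)))) with false.
    2:{ symmetry; apply not_true_is_false; intros H.
        apply integral_true in H as (l & H & _).
        pose proof (rainbow_In _ _ 0 H (Nat.lt_0_succ _)) as Hin.
        apply in_map_iff in Hin as (x & Hx & Hin).
        apply in_map_iff in Hin as (w & <- & _).
        specialize (H0 (0 :: w) 0 ltac:(lia) eq_refl); lia. }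
    (* The opposite face remains. Label [S d] is excluded there, so it is a Sperner labelled cube of
       dimension [d]. *)
    rewrite xorb_false_l, xorb_false_r.
    rewrite <- (IH (fun x => lab (N :: x))).
    + apply integral_ext; intros l; now rewrite map_map.
    + intros x. specialize (Hle (N :: x)).
      specialize (HN (N :: x) 0 ltac:(lia) eq_refl); lia.
    + intros x i Hi Hx. specialize (H0 (N :: x) (S i) ltac:(lia) Hx); lia.
    + intros x i Hi Hx. specialize (HN (N :: x) (S i) ltac:(lia) Hx); lia.
Qed.

Lemma sperner_grid N d (lab : list nat -> nat) :
  (forall x, lab x <= d) ->
  (forall x i, i < d -> nth i x 0 = 0 -> d - i <= lab x) ->
  (forall x i, i < d -> nth i x 0 = N -> lab x <> d - i) ->
  exists l, (forall x, In x l -> length x = d) /\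
    (forall x y, In x l -> In y l -> near x y) /\
    (forall j, j <= d -> exists x, In x l /\ lab x = j).
Proof.
  intros Hle H0 HN.
  pose proof (integral_rainbow N d lab Hle H0 HN) as H.
  apply integral_true in H as (l & H & Hl & Hn).
  exists l; repeat split; auto.
  intros j Hj. apply rainbow_In with (j := j) in H; [|lia].
  apply in_map_iff in H as (x & Hx & Hin); eauto.
Qed.

(** * Reachability in graphs *)

Lemma reach_refl {V : Type} (adj : V -> V -> Prop) n u : reach adj n u u.
Proof. destruct n; simpl; auto. Qed.

Lemma reach_trans {V : Type} (adj : V -> V -> Prop) m n u v w :
  reach adj m u v -> reach adj n v w -> reach adj (m + n) u w.
Proof.
  assert (Hmono : forall k n u v, reach adj n u v -> reach adj (k + n) u v).
  { clear; intros k; induction k as [|k IH]; simpl; auto.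
    intros n u v H; apply IH in H; clear IH.
    revert H; generalize (k + n) as j; intros j; revert u.
    induction j as [|j IH]; simpl; intros u; auto.
    intros [H|(w & Hw & H)]; auto. right; exists w; split; auto. }
  revert u; induction m as [|m IH]; intros u; simpl.
  - now intros ->.
  - intros [->|(x & Hx & H)] Hn.
    + apply (Hmono (S m)); auto.
    + right; eauto.
Qed.

Lemma reach_le {V : Type} (adj : V -> V -> Prop) m n u v :
  m <= n -> reach adj m u v -> reach adj n u v.
Proof.
  intros Hmn H. replace n with (m + (n - m)) by lia.
  eapply reach_trans; eauto. apply reach_refl.
Qed.

Lemma reach_sym {V : Type} (adj : V -> V -> Prop) n u v :
  (forall x y, adj x y -> adj y x) -> reach adj n u v -> reach adj n v u.
Proof.
  intros Hs; revert u; induction n as [|n IH]; intros u; simpl; auto.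
  intros [->|(w & Hw & H)]; auto.
  change (reach adj (S n) v u). rewrite <- Nat.add_1_r.
  eapply reach_trans; eauto. simpl; right; exists u; auto.
Qed.

Lemma reach_last {V : Type} (adj : V -> V -> Prop) n u v :
  reach adj (S n) u v -> u = v \/ exists w, reach adj n u w /\ adj w v.
Proof.
  revert u; induction n as [|n IH]; intros u.
  - simpl. intros [->|(w & Hw & ->)]; eauto.
  - intros [->|(w & Hw & H)]; auto.
    apply IH in H as [->|(x & Hx & H)]; right.
    + exists u; split; auto. apply reach_refl.
    + exists x; split; auto. right; eauto.
Qed.

(** Any list containing the ball suffices: filtering by reachability and removing duplicates, both
    decided classically, gives the exact ball. *)
Lemma growth_of_ball_lists {V : Type} (adj : V -> V -> Prop) (f : nat -> R) :
  (forall x y, adj x y -> adj y x) ->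
  (forall r v, exists L, (forall u, reach adj r v u -> In u L) /\
     (INR (length L) <= f r)%R) ->
  has_growth_at_most adj f.
Proof.
  intros Hs H r v. destruct (H r v) as (L & HL & Hlen).
  assert (Hdec : forall x y : V, {x = y} + {x <> y})
    by (intros; apply excluded_middle_informative).
  pose (p := fun u => if excluded_middle_informative (reach adj r v u)
                      then true else false).
  exists (nodup Hdec (filter p L)); split; [apply NoDup_nodup | split].
  - intros u. rewrite nodup_In, filter_In. unfold p.
    split.
    + intros [_ Hp]. destruct (excluded_middle_informative _) as [Hr|]; [|discriminate].
      exists r; split; [lra|]. apply reach_sym; auto.
    + intros (n & Hn & Hr). apply INR_le in Hn.
      apply reach_le with (n := r), reach_sym in Hr; auto.
      split; auto. destruct (excluded_middle_informative _); auto.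
  - apply Rle_trans with (2 := Hlen). apply le_INR.
    apply Nat.le_trans with (length (filter p L)).
    + apply NoDup_incl_length; [apply NoDup_nodup|].
      intros x; apply nodup_In.
    + apply filter_length_le.
Qed.

(** * A subdivided cubic graph quasi-isometric to the grid *)

Inductive port := P0 | P1 | P2.

Definition rot (p : port) : port :=
  match p with P0 => P1 | P1 => P2 | P2 => P0 end.

(* The two involutions of the ray [0 - 1 - 2 - ...] whose orbits are its edges:
   [{2a, 2a+1}] for [true] and [{2a+1, 2a+2}] for [false], the latter fixing [0]. *)
Definition toggle (b : bool) (a : nat) : nat :=
  if Bool.eqb (Nat.even a) b then S a else Nat.pred a.

Fixpoint update (i : nat) (g : nat -> nat) (l : list nat) : list nat :=
  match l, i with
  | [], _ => []
  | a :: l', 0 => g a :: l'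
  | a :: l', S i' => a :: update i' g l'
  end.

(** A half-edge: a vertex of the cubic graph with one of its three ports. [rho] turns to the next
    port of the vertex, and [tau] passes to the other end of the edge. *)
Definition dart := (port * list nat)%type.

Definition rho (e : dart) : dart := (rot (fst e), snd e).

(* In a dart [(p, j :: x)], ports [P0] and [P1] move the counter [j] along its ray, and
   port [P2] moves coordinate [j / 2] of the grid point [x]; both directions of every
   coordinate of [x] are thus available although each vertex has only three ports. *)
Definition tau (e : dart) : dart :=
  let (p, y) := e in
  match p with
  | P0 => (P0, update 0 (toggle true) y)
  | P1 => (P1, update 0 (toggle false) y)
  | P2 => (P2, update (S (Nat.div2 (hd 0 y))) (toggle (Nat.even (hd 0 y))) y)
  end.

Lemma toggle_involutive b a : toggle b (toggle b a) = a.
Proof.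
  assert (Hs : forall c, Nat.even (S c) = negb (Nat.even c))
    by (intros c; now rewrite Nat.even_succ, Nat.negb_even).
  unfold toggle. destruct (Bool.eqb (Nat.even a) b) eqn:E.
  - rewrite Hs. destruct (Nat.even a), b; try discriminate; reflexivity.
  - destruct a as [|a]; cbn [Nat.pred]; [now rewrite E|].
    rewrite Hs in E. destruct (Nat.even a), b; try discriminate; reflexivity.
Qed.

Lemma toggle_close b a : toggle b a <= S a /\ a <= S (toggle b a).
Proof. unfold toggle; destruct (Bool.eqb _ _); lia. Qed.

Lemma toggle_reaches a a' :
  a <= S a' -> a' <= S a -> a' = a \/ exists b, a' = toggle b a.
Proof.
  intros H1 H2. destruct (Nat.eq_dec a' a); auto. right.
  destruct (Nat.eq_dec a' (S a)).
  - exists (Nat.even a); unfold toggle. now rewrite eqb_reflx.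
  - exists (negb (Nat.even a)); unfold toggle. destruct (Nat.even a); simpl; lia.
Qed.

Lemma update_involutive i g l : (forall a, g (g a) = a) -> update i g (update i g l) = l.
Proof.
  intros Hg; revert i; induction l as [|a l IH]; intros [|i]; simpl; auto; f_equal; auto.
Qed.

Lemma update_length i g l : length (update i g l) = length l.
Proof. revert i; induction l as [|a l IH]; intros [|i]; simpl; auto. Qed.

Lemma update_app g l1 a l2 :
  update (length l1) g (l1 ++ a :: l2) = l1 ++ g a :: l2.
Proof. induction l1 as [|b l1 IH]; simpl; congruence. Qed.

Definition close (n : nat) : list nat -> list nat -> Prop :=
  Forall2 (fun a b => a <= b + n /\ b <= a + n).

Lemma close_refl n l : close n l l.
Proof. induction l; constructor; auto; lia. Qed.

Lemma close_sym n l l' : close n l l' -> close n l' l.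
Proof. induction 1; constructor; auto; lia. Qed.

Lemma close_trans m n l l' l'' : close m l l' -> close n l' l'' -> close (m + n) l l''.
Proof.
  intros H; revert l''; induction H; intros l'' H'; inversion H'; subst; constructor.
  - lia.
  - apply IHForall2; auto.
Qed.

Lemma close_nth n l l' i : close n l l' -> nth i l 0 <= nth i l' 0 + n.
Proof.
  intros H; revert i; induction H; intros [|i]; simpl; try lia. apply IHForall2.
Qed.

Lemma update_close i b l : close 1 l (update i (toggle b) l).
Proof.
  revert i; induction l as [|a l IH]; intros [|i]; simpl; try constructor;
    try apply close_refl; try apply IH; try lia.
  pose proof (toggle_close b a); lia.
Qed.

Lemma rho_cubed e : rho (rho (rho e)) = e.
Proof. destruct e as [[] y]; reflexivity. Qed.

Lemma tau_involutive e : tau (tau e) = e.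
Proof.
  destruct e as [[] y]; unfold tau; f_equal;
    try (apply update_involutive, toggle_involutive).
  (* A move through [P2] does not change the counter, so the second move applies the same toggle to
     the same coordinate. *)
  replace (hd 0 (update _ _ y)) with (hd 0 y) by now destruct y.
  apply update_involutive, toggle_involutive.
Qed.

Lemma tau_close e : close 1 (snd e) (snd (tau e)).
Proof. destruct e as [[] y]; apply update_close. Qed.

Lemma tau_length e : length (snd (tau e)) = length (snd e).
Proof. destruct e as [[] y]; apply update_length. Qed.

(* Every dart [e] becomes an arm [(e,0), ..., (e,k)]; the roots of the three arms of a
   vertex form a triangle and the tips of [e] and [tau e] are joined. *)
Definition step (k : nat) (u v : dart * nat) : Prop :=
  (fst v = fst u /\ snd v = S (snd u)) \/
  (fst v = rho (fst u) /\ snd u = 0 /\ snd v = 0) \/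
  (fst v = tau (fst u) /\ snd u = k /\ snd v = k).

(* All vertices that are not valid are isolated. *)
Definition valid (m k : nat) (u : dart * nat) : Prop :=
  length (snd (fst u)) = m /\ snd u <= k.

Definition arm_adj (m k : nat) (u v : dart * nat) : Prop :=
  u <> v /\ valid m k u /\ valid m k v /\ (step k u v \/ step k v u).

Lemma arm_adj_sym m k u v : arm_adj m k u v -> arm_adj m k v u.
Proof. unfold arm_adj; intuition auto. Qed.

Lemma arm_adj_simple m k : simple_graph (arm_adj m k).
Proof.
  split; [apply arm_adj_sym|]. intros v [H _]; auto.
Qed.

Lemma step_close k u v :
  step k u v -> close 1 (snd (fst u)) (snd (fst v)) /\ snd u <= S (snd v) /\ snd v <= S (snd u).
Proof.
  intros [[-> ->]|[(-> & -> & ->)|(-> & -> & ->)]]; (split; [|lia]).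
  - apply close_refl.
  - apply close_refl.
  - apply tau_close.
Qed.

(** An edge changes each coordinate and the height by at most 1. This gives both the polynomial
    growth and the lower bound on distances across the cube. *)
Lemma reach_close m k n u v :
  reach (arm_adj m k) n u v ->
  close n (snd (fst u)) (snd (fst v)) /\ snd u <= snd v + n /\ snd v <= snd u + n.
Proof.
  revert u; induction n as [|n IH]; intros u; simpl.
  - intros ->; split; [apply close_refl | lia].
  - intros [->|(w & (_ & _ & _ & Hst) & H)]; [split; [apply close_refl | lia]|].
    assert (H1 : close 1 (snd (fst u)) (snd (fst w)) /\
                 snd u <= S (snd w) /\ snd w <= S (snd u)).
    { destruct Hst as [Hst|Hst]; apply step_close in Hst; auto.
      split; [apply close_sym|]; tauto. }
    apply IH in H. split; [|lia].
    apply (close_trans 1 n) with (snd (fst w)); tauto.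
Qed.

(** ** Distances between grid points *)

Definition root_reach (m k n : nat) (e e' : dart) : Prop :=
  reach (arm_adj m k) n (e, 0) (e', 0).

Lemma step_reach m k u v :
  valid m k u -> valid m k v -> step k u v -> reach (arm_adj m k) 1 u v.
Proof.
  intros Hu Hv H. destruct (classic (u = v)) as [->|Hne]; [apply reach_refl|].
  right; exists v; split; [|reflexivity]. unfold arm_adj; auto.
Qed.

Lemma root_reach_rho m k e :
  length (snd e) = m -> root_reach m k (2 * k + 1) e (rho e).
Proof.
  intros He. apply reach_le with 1; [lia|]. apply step_reach.
  - split; simpl; auto; lia.
  - split; simpl; auto; lia.
  - right; left; auto.
Qed.

Lemma root_reach_tau m k e :
  length (snd e) = m -> root_reach m k (2 * k + 1) e (tau e).
Proof.
  intros He.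
  assert (Harm : forall e i, length (snd e) = m -> i <= k ->
    reach (arm_adj m k) i (e, 0) (e, i)).
  { intros e' i He'; induction i as [|i IH]; intros Hi; [apply reach_refl|].
    rewrite <- Nat.add_1_r at 1. apply reach_trans with (e', i); [apply IH; lia|].
    apply step_reach; [split; simpl; auto; lia .. |]. left; auto. }
  replace (2 * k + 1) with (k + 1 + k) by lia.
  apply reach_trans with (tau e, k).
  - apply reach_trans with (e, k); auto.
    apply step_reach.
    + split; simpl; auto.
    + split; simpl; auto. now rewrite tau_length.
    + right; right; auto.
  - apply reach_sym; [apply arm_adj_sym|]. apply Harm; auto. now rewrite tau_length.
Qed.

Lemma root_reach_trans m k a b c e e' e'' :
  root_reach m k a e e' -> root_reach m k b e' e'' -> a + b <= c -> root_reach m k c e e''.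
Proof.
  intros H1 H2 Hc. apply reach_le with (a + b); auto. eapply reach_trans; eauto.
Qed.

(** An even counter is incremented through [P0] directly. An odd one takes four moves: turn to [P1],
    cross, and turn twice to be back at [P0]. *)
Lemma root_reach_counter m k j x :
  length x = m -> root_reach (S m) k (j * (4 * (2 * k + 1))) (P0, 0 :: x) (P0, j :: x).
Proof.
  intros Hx; induction j as [|j IH]; [apply reach_refl|].
  apply root_reach_trans with (1 := IH) (b := 4 * (2 * k + 1)); [|lia].
  clear IH.
  assert (Hl : forall p i, length (snd ((p, i :: x) : dart)) = S m) by (simpl; auto).
  pose proof (fun p i => root_reach_rho _ k _ (Hl p i)) as Hr.
  pose proof (fun p i => root_reach_tau _ k _ (Hl p i)) as Ht.
  destruct (Nat.even j) eqn:E.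
  - specialize (Ht P0 j). unfold tau, update, toggle in Ht. rewrite E in Ht.
    eapply reach_le; [|exact Ht]; lia.
  - specialize (Ht P1 j). unfold tau, update, toggle in Ht. rewrite E in Ht.
    eapply root_reach_trans; [exact (Hr P0 j) | | apply Nat.le_refl].
    eapply root_reach_trans; [exact Ht | | apply Nat.le_refl].
    eapply root_reach_trans; [exact (Hr P1 _) | exact (Hr P2 _) |]. lia.
Qed.

(** The counter is driven to the value [j <= 2 * m] that governs this toggle and back again, at most
    [8 * m] moves each way. In between come two turns to [P2], the crossing and one turn back to
    [P0]. *)
Lemma root_reach_toggle m k i b x :
  length x = m -> i < m ->
  root_reach (S m) k ((16 * m + 4) * (2 * k + 1)) (P0, 0 :: x)
    (P0, 0 :: update i (toggle b) x).
Proof.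
  intros Hx Hi.
  set (j := if b then 2 * i else S (2 * i)).
  assert (Hj : Nat.div2 j = i /\ Nat.even j = b /\ j <= 2 * m).
  { unfold j; destruct b.
    - rewrite Nat.div2_double, Nat.even_mul; simpl; lia.
    - rewrite Nat.div2_succ_double, Nat.even_succ, Nat.odd_mul; simpl; lia. }
  destruct Hj as (Hd & He & Hm).
  set (x' := update i (toggle b) x).
  assert (Hx' : length x' = m) by (unfold x'; now rewrite update_length).
  assert (Ht : root_reach (S m) k (2 * k + 1) (P2, j :: x) (P2, j :: x')).
  { pose proof (root_reach_tau (S m) k (P2, j :: x)) as H.
    unfold tau in H. cbn [hd] in H. rewrite Hd, He in H. apply H; simpl; auto. }
  assert (Hr : forall p z, length z = m ->
    root_reach (S m) k (2 * k + 1) (p, j :: z) (rot p, j :: z)).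
  { intros p z Hz. apply (root_reach_rho (S m) k (p, j :: z)); simpl; auto. }
  pose proof (root_reach_counter m k j x Hx) as H1.
  pose proof (root_reach_counter m k j x' Hx') as H2.
  apply reach_sym in H2; [|apply arm_adj_sym].
  eapply root_reach_trans; [exact H1 | | ].
  eapply root_reach_trans; [exact (Hr P0 x Hx) | | apply Nat.le_refl].
  eapply root_reach_trans; [exact (Hr P1 x Hx) | | apply Nat.le_refl].
  eapply root_reach_trans; [exact Ht | | apply Nat.le_refl].
  eapply root_reach_trans; [exact (Hr P2 x' Hx') | exact H2 | apply Nat.le_refl].
  nia.
Qed.

Definition grid_point (x : list nat) : dart * nat := ((P0, 0 :: x), 0).

Lemma grid_point_reach m k x y :
  length x = m -> near x y ->
  reach (arm_adj (S m) k) (m * ((16 * m + 4) * (2 * k + 1))) (grid_point x) (grid_point y).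
Proof.
  intros Hx Hn. unfold grid_point.
  set (c := (16 * m + 4) * (2 * k + 1)).
  (* Coordinates are adjusted one at a time; [z] holds those already done. *)
  enough (H : forall z, length (z ++ x) = m ->
    root_reach (S m) k (length x * c) (P0, 0 :: z ++ x) (P0, 0 :: z ++ y)).
  { rewrite <- Hx at 2. apply (H []); auto. }
  clear Hx; induction Hn as [|a b x y Hab Hn IH]; intros z Hz.
  - apply reach_refl.
  - cbn [length]. rewrite Nat.mul_succ_l.
    replace (z ++ b :: y) with ((z ++ [b]) ++ y) by now rewrite <- app_assoc.
    eapply root_reach_trans;
      [ | apply IH; rewrite <- app_assoc; rewrite length_app in *; simpl in *; lia
        | apply Nat.eq_le_incl, Nat.add_comm ].
    replace ((z ++ [b]) ++ x) with (z ++ b :: x) by now rewrite <- app_assoc.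
    destruct (toggle_reaches a b) as [->|[t ->]]; try tauto; [apply reach_refl|].
    rewrite <- (update_app (toggle t)). apply root_reach_toggle; auto.
    rewrite length_app in Hz; simpl in Hz; lia.
Qed.

(** ** Growth *)

(** Estimate for the ball about height [i] of the arm [e], by cases: the arm itself, the other two
    arms at its triangle, and the arm [tau e] beyond the tip. Height [j] of [tau e] lies at distance
    [2 * k + 1 - j] from the root of [e] along the subdivided edge. *)
Definition small_ball (k : nat) (e : dart) (i n : nat) (u : dart * nat) : Prop :=
  (fst u = e /\ i <= snd u + n /\ snd u <= i + n /\ snd u <= k) \/
  ((fst u = rho e \/ fst u = rho (rho e)) /\ i + 1 + snd u <= n) \/
  (fst u = tau e /\ 2 * k + 1 <= i + snd u + n /\ snd u <= k).

(** A path of length at most [k / 2] is too short to traverse an arm, so the cases that would pass a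
    second junction contradict the inequalities. *)
Lemma reach_small_ball m k e i n u :
  i <= k -> 2 * n <= k -> reach (arm_adj m k) n (e, i) u -> small_ball k e i n u.
Proof.
  intros Hi; revert u; induction n as [|n IH]; intros u Hn H.
  - simpl in H; subst u. left; cbn [fst snd]; split; [reflexivity | lia].
  - apply reach_last in H as [<-|(w & H & (_ & [_ Hw] & [_ Hu] & Hst))].
    + left; cbn [fst snd]; split; [reflexivity | lia].
    + apply IH in H; [|lia]. clear IH.
      destruct u as [e1 i1], w as [e2 i2]; unfold small_ball, step in *; cbn [fst snd] in *.
      assert (Hrho : forall a b, a = rho b -> b = rho (rho a))
        by (intros a b ->; now rewrite rho_cubed).
      assert (Htau : forall a b, a = tau b -> b = tau a)
        by (intros a b ->; now rewrite tau_involutive).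
      assert (Hst' : (e1 = e2 /\ (i1 = S i2 \/ i2 = S i1)) \/
        ((e1 = rho e2 \/ e1 = rho (rho e2)) /\ i1 = 0 /\ i2 = 0) \/
        (e1 = tau e2 /\ i1 = k /\ i2 = k)).
      { destruct Hst as [[[]|[[]|[]]]|[[]|[[]|[]]]]; intuition (subst; auto). }
      clear Hst Htau Hrho.
      destruct H as [(-> & H)|[[[->| ->] H]|(-> & H)]];
        destruct Hst' as [[-> Hs]|[[[->| ->] Hs]|(-> & Hs)]];
        rewrite ?rho_cubed, ?tau_involutive;
        first [ exfalso; lia | left; split; [reflexivity | lia]
              | right; left; split; [auto | lia] | right; right; split; [reflexivity | lia] ].
Qed.

Lemma small_ball_list k e i n :
  i <= k -> 2 * n <= k ->
  exists L, (forall u, small_ball k e i n u -> In u L) /\ length L <= 3 * n + 1.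
Proof.
  intros Hi Hn. destruct (le_lt_dec i n) as [Hin|Hin].
  (* The tip edge is out of reach, and the tripod has [(i + n + 1) + 2 * (n - i)] vertices. *)
  - exists (map (pair e) (seq 0 (i + n + 1)) ++ map (pair (rho e)) (seq 0 (n - i)) ++
            map (pair (rho (rho e))) (seq 0 (n - i))).
    split; [|rewrite !length_app, !length_map, !length_seq; lia].
    intros [e' i'] H; unfold small_ball in H; cbn [fst snd] in H.
    rewrite !in_app_iff.
    destruct H as [(-> & H)|[[[->| ->] H]|(-> & H)]]; [left | right; left | right; right | lia];
      apply in_map, in_seq; lia.
  (* The root is too far to turn, so the ball lies on a path; positions [j > k] on it belong to the
     arm [tau e]. *)
  - exists (map (fun j => if j <=? k then (e, j) else (tau e, 2 * k + 1 - j))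
                (seq (i - n) (2 * n + 1))).
    split; [|rewrite length_map, length_seq; lia].
    intros [e' i'] H; unfold small_ball in H; cbn [fst snd] in H.
    apply in_map_iff.
    destruct H as [(-> & H)|[[_ H]|(-> & H)]]; [| lia |].
    + exists i'. rewrite in_seq. destruct (Nat.leb_spec i' k); [split; auto; lia | lia].
    + exists (2 * k + 1 - i'). rewrite in_seq.
      destruct (Nat.leb_spec (2 * k + 1 - i') k); [lia|].
      split; [f_equal; lia | lia].
Qed.

Fixpoint box (n : nat) (x : list nat) : list (list nat) :=
  match x with
  | [] => [[]]
  | a :: x' => map (fun c => fst c :: snd c) (list_prod (seq (a - n) (2 * n + 1)) (box n x'))
  end.

Lemma in_box n x y : close n x y -> In y (box n x).
Proof.
  induction 1 as [|a b x y Hab H IH]; simpl; auto.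
  apply in_map_iff. exists (b, y); split; auto.
  apply in_prod; auto. apply in_seq; lia.
Qed.

Lemma length_box n x : length (box n x) = (2 * n + 1) ^ length x.
Proof.
  induction x as [|a x IH]; auto. cbn [box length Nat.pow].
  now rewrite length_map, length_prod, length_seq, IH.
Qed.

(** The port is arbitrary, while the [m] coordinates and the height each range over an interval of
    [2 * n + 1] values. *)
Lemma large_ball_list m k n v :
  length (snd (fst v)) = m ->
  exists L, (forall u, reach (arm_adj m k) n v u -> In u L) /\
    length L = 3 * (2 * n + 1) ^ S m.
Proof.
  destruct v as [[q x] j]; cbn [fst snd]; intros Hm.
  exists (list_prod (list_prod [P0; P1; P2] (box n x))
                    (seq (j - n) (2 * n + 1))).
  split.
  - intros [[p y] i] H. apply reach_close in H as (Hc & Hi); cbn [fst snd] in *.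
    apply in_prod; [apply in_prod|].
    + destruct p; simpl; auto.
    + now apply in_box.
    + apply in_seq; lia.
  - rewrite !length_prod, length_box, length_seq, Hm, Nat.pow_succ_r'. cbn [length]; lia.
Qed.

Lemma invalid_isolated m k n v u :
  ~ valid m k v -> reach (arm_adj m k) n v u -> u = v.
Proof.
  intros Hv; destruct n; simpl; [congruence|].
  intros [?|(w & (_ & H & _) & _)]; [congruence | contradiction].
Qed.

Lemma superpolynomial_ge_pow f M :
  superpolynomial f -> exists N, forall r, N <= r -> (INR r ^ M <= f r)%R.
Proof.
  intros (g & (N0 & H0) & Hg). destruct (Hg (INR M)) as [N1 H1].
  exists (N0 + N1 + 1); intros r Hr.
  rewrite H0 by lia. rewrite <- Rpower_pow by (apply lt_0_INR; lia).
  assert (Hr1 : (1 <= INR r)%R) by (apply (le_INR 1); lia).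
  destruct Hr1 as [Hr1|<-].
  - apply Rle_Rpower; [lra|]. apply H1; lia.
  - unfold Rpower. rewrite ln_1, !Rmult_0_r. lra.
Qed.

Lemma arm_graph_growth f m :
  superpolynomial f -> (forall r, 3 * INR r + 1 <= f r)%R ->
  exists k, growth_class f _ (arm_adj m k).
Proof.
  intros Hsup Hf.
  (* For [r >= 3] both [3 <= r] and [2 * r + 1 <= r ^ 2], so [3 * (2 * r + 1) ^ S m] is at most
     [r ^ S (2 * S m)]. *)
  destruct (superpolynomial_ge_pow f (S (2 * S m)) Hsup) as [N HN].
  (* Radii up to [N + 3] are then at most half an arm, and larger ones are in the range of the power
     bound. *)
  exists (2 * (N + 3)).
  split; [apply arm_adj_simple|].
  apply growth_of_ball_lists; [apply arm_adj_sym|].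
  intros r v.
  assert (Hf' : forall l, l <= 3 * r + 1 -> (INR l <= f r)%R).
  { intros l Hl; eapply Rle_trans; [apply le_INR, Hl|].
    rewrite plus_INR, mult_INR. apply Rle_trans with (2 := Hf r). simpl; lra. }
  destruct (classic (valid m (2 * (N + 3)) v)) as [[Hm Hi]|Hv].
  - destruct (le_lt_dec r (N + 3)) as [Hr|Hr].
    + destruct v as [e i].
      destruct (small_ball_list (2 * (N + 3)) e i r) as (L & HL & Hlen); [exact Hi | lia |].
      exists L; split; auto.
      intros u H; apply HL. eapply reach_small_ball; eauto; lia.
    + destruct (large_ball_list m (2 * (N + 3)) r v Hm) as (L & HL & Hlen).
      exists L; split; auto. rewrite Hlen.
      apply Rle_trans with (2 := HN r ltac:(lia)).
      rewrite <- pow_INR. apply le_INR. rewrite (Nat.pow_succ_r' r), Nat.pow_mul_r.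
      apply Nat.mul_le_mono; [lia|]. apply Nat.pow_le_mono_l.
      rewrite Nat.pow_2_r; nia.
  - exists [v]; split; [|apply Hf'; simpl; lia].
    intros u Hu; left; symmetry; eapply invalid_isolated; eauto.
Qed.

(** * The covering argument *)

Lemma exists_max_label (Q : nat -> Prop) d :
  exists m, m <= d /\ (forall j, 1 <= j <= d -> Q j -> j <= m) /\ (m = 0 \/ Q m).
Proof.
  induction d as [|d (m & Hm & Hmax & HQ)].
  - exists 0; repeat split; auto; lia.
  - destruct (classic (Q (S d))) as [H|H].
    + exists (S d); repeat split; auto; lia.
    + exists m; repeat split; auto. intros j Hj Hq.
      apply Hmax; auto. assert (j <> S d) by (intros ->; auto). lia.
Qed.

Lemma not_control_function_arm_graph n k D : ~ control_function (arm_adj (S (S n)) k) n D.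
Proof.
  intros Hctl. set (d := S n) in *.
  set (K := d * ((16 * d + 4) * (2 * k + 1))).
  set (r := (INR K + 1)%R).
  assert (Hr : (0 < r)%R) by (unfold r; pose proof (pos_INR K); lra).
  destruct (Hctl r Hr) as (U & Hcov & HU).
  destruct (INR_unbounded (D r)) as [N HN].
  destruct (functional_choice _ (fun x => Hcov (grid_point x))) as [col Hcol].
  destruct (functional_choice _ Hcol) as [A HA]. clear Hcov Hcol.
  (* [Q x j]: the set chosen for [x] meets the face carrying label [j]. The default [0] of [nth]
     counts missing coordinates as zero, as in [sperner_grid]. *)
  pose (Q := fun x j => exists y, A x (grid_point y) /\ nth (d - j) y 0 = 0).
  destruct (functional_choice _ (fun x => exists_max_label (Q x) d)) as [lab Hlab].
  destruct (sperner_grid N d lab) as (l & Hlen & Hnear & Hall).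
  - intros x; apply Hlab.
  - intros x i Hi Hx. apply Hlab; [lia|].
    exists x; split; [apply HA|]. now replace (d - (d - i)) with i by lia.
  - intros x i Hi Hx Heq.
    (* If [x] had the excluded label, its set would join opposite faces of the cube, whose side [N]
       exceeds the diameter bound [D r]. *)
    destruct (Hlab x) as (_ & _ & [H|(y & Hy & Hy0)]); [lia|].
    rewrite Heq in Hy0. replace (d - (d - i)) with i in Hy0 by lia.
    destruct (HA x) as (Hc & HUA & HAx).
    destruct (proj2 (HU _ Hc) _ _ _ HUA HAx Hy) as (p & Hp & Hreach).
    apply reach_close in Hreach as [Hclose _]. cbn [fst snd grid_point] in Hclose.
    apply close_nth with (i := S i) in Hclose. cbn [nth] in Hclose.
    assert (p < N) by (apply INR_lt; lra). lia.
  (* Points of the small simplex are at distance at most [K < r], so equal colours force equal sets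
     and hence equal labels. *)
  - assert (Hsame : forall x y, In x l -> In y l -> col x = col y -> lab x = lab y).
    { intros x y Hx Hy Hxy.
      destruct (HA x) as (Hcx & HUx & HAx), (HA y) as (Hcy & HUy & HAy).
      assert (Heq : forall z, A x z <-> A y z).
      { apply NNPP; intros Hne. rewrite Hxy in HUx.
        apply (proj1 (HU _ Hcy) _ _ _ _ HUx HUy HAx HAy Hne).
        exists K; split; [unfold r; lra|]. apply grid_point_reach; auto. }
      assert (HQ : forall j, Q x j <-> Q y j).
      { intros j; unfold Q; split; intros (z & Hz & Hz0); exists z; split; auto; now apply Heq. }
      destruct (Hlab x) as (Hx1 & Hx2 & Hx3), (Hlab y) as (Hy1 & Hy2 & Hy3).
      apply Nat.le_antisymm.
      - destruct Hx3 as [->|Hx3]; [lia|]. destruct (Nat.eq_dec (lab x) 0); [lia|].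
        apply Hy2; [lia|]. now apply HQ.
      - destruct Hy3 as [->|Hy3]; [lia|]. destruct (Nat.eq_dec (lab y) 0); [lia|].
        apply Hx2; [lia|]. now apply HQ. }
    assert (Hg : forall c, exists b, forall x, In x l -> col x = c -> lab x = b).
    { intros c. destruct (classic (exists x, In x l /\ col x = c)) as [(x & Hx & <-)|H].
      - exists (lab x); auto.
      - exists 0; intros x Hx Hc; exfalso; eauto. }
    apply functional_choice in Hg as [g Hg].
    (* Labels factor through colours via [g], but there are [d + 1] labels and only [d = n + 1]
       colours. *)
    assert (Hincl : incl (seq 0 (S d)) (map g (seq 0 d))).
    { intros j Hj; apply in_seq in Hj.
      destruct (Hall j) as (x & Hx & <-); [lia|].
      apply in_map_iff; exists (col x); split; [symmetry; apply Hg; auto|].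
      apply in_seq. destruct (HA x) as [Hc _]. lia. }
    apply NoDup_incl_length in Hincl; [|apply seq_NoDup].
    rewrite length_map, !length_seq in Hincl. lia.
Qed.

Open Scope R_scope.

Theorem theorem6p5 (f : nat -> R) (Hsup : superpolynomial f)
  (Hf : forall r : nat, 3 * INR r + 1 <= f r) :
  forall n : nat, ~ class_asdim_le (growth_class f) n.
Proof.
  intros n (D & _ & HD).
  destruct (arm_graph_growth f (S (S n)) Hsup Hf) as [k Hk].
  exact (not_control_function_arm_graph n k D (HD _ _ Hk)).
Qed.
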